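(* Let $X\neq\{0\}$ be a real Hilbert space, let $m\geq 3$ be an integer, $I=\{1,\ldots,m\}$, let $A_1,\ldots,A_m$ be maximally monotone operators on $X$, and suppose that $\lambda_i=\tfrac1m$ for every $i\in I$. Put $\mu_i=1-\lambda_i$ for $i\in I$, $\mathbf{X}=X^m$, and define $$\mathbf{R}\colon\mathbf{X}\to\mathbf{X}\colon(x_i)_{i\in I}\mapsto\Big(\sum_{j\in I\smallsetminus\{i\}}\frac{\lambda_j}{\mu_i}x_j\Big)_{i\in I},\qquad \mathbf{J}\colon\mathbf{X}\to\mathbf{X}\colon(x_i)_{i\in I}\mapsto\big(J_{\mu_i^{-1}A_i}x_i\big)_{i\in I},$$ $$\mathbf{S}=\Big\{(x_i)_{i\in I}\in\mathbf{X}\;\Big|\;(\forall i\in I)\;\;x_i=J_{\mu_i^{-1}A_i}\Big(\sum_{j\in I\smallsetminus\{i\}}\frac{\lambda_j}{\mu_i}x_j\Big)\Big\}.$$ Then $\mathbf{J}\circ\mathbf{R}$ is $\tfrac{2m}{3m-2}$-averaged and $\operatorname{Fix}(\mathbf{J}\circ\mathbf{R})=\mathbf{S}$.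
   Context: A set-valued operator $B\colon X\rightrightarrows X$ is monotone if $\langle x-y,u-v\rangle\geq 0$ whenever $u\in Bx$ and $v\in By$; it is maximally monotone if it is monotone and no proper extension of (the graph of) $B$ is monotone. For a maximally monotone operator $B$ on $X$, its resolvent is $J_B=(\operatorname{Id}+B)^{-1}$, which is a single-valued mapping defined on all of $X$. The product $\mathbf{X}=X^m$ is a Hilbert space with inner product $\langle\mathbf{x},\mathbf{y}\rangle=\sum_{i\in I}\langle x_i,y_i\rangle$. For a self-mapping $T$ of a Hilbert space, $\operatorname{Fix}T$ is its set of fixed points; $T$ is nonexpansive if it is Lipschitz continuous with constant $1$; and, for $\alpha\in\left[0,1\right[$, $T$ is $\alpha$-averaged if there exists a nonexpansive self-mapping $N$ of that space with $T=(1-\alpha)\operatorname{Id}+\alpha N$. *)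

(* Defs.v *)
From HB Require Import structures.
From mathcomp Require Import all_boot all_order all_algebra.
From mathcomp Require Import all_classical all_reals all_analysis.

Set Implicit Arguments.
Unset Strict Implicit.
Unset Printing Implicit Defensive.

Import Order.TTheory GRing.Theory Num.Theory.
Import numFieldNormedType.Exports.
Local Open Scope classical_set_scope.
Local Open Scope ring_scope.

Section InnerProduct.
Variables (R : realType) (V : lmodType R) (ip : {dot V for idfun}).

Definition ip_norm (x : V) : R := Num.sqrt (ip x x).

Definition nonexpansive (T : V -> V) : Prop :=
  forall x y, ip_norm (T x - T y) <= ip_norm (x - y).

Definition averaged (alpha : R) (T : V -> V) : Prop :=
  0 <= alpha < 1 /\
  exists N : V -> V, nonexpansive N /\
    forall x, T x = (1 - alpha) *: x + alpha *: N x.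

(* A set-valued operator is a function V -> set V; its graph is
   {(x, u) | u \in B x}. *)
Definition monotone_op (B : V -> set V) : Prop :=
  forall x y u v, B x u -> B y v -> 0 <= ip (x - y) (u - v).

Definition maximally_monotone (B : V -> set V) : Prop :=
  monotone_op B /\
  forall C : V -> set V, monotone_op C -> (forall x, B x `<=` C x) -> C = B.

End InnerProduct.

Section Operators.
Variables (R : realType) (V : lmodType R).

Definition scale_op (c : R) (B : V -> set V) : V -> set V :=
  fun x => [set c *: u | u in B x].

Definition id_plus_op (B : V -> set V) : V -> set V :=
  fun x => [set x + u | u in B x].

Definition inv_op (B : V -> set V) : V -> set V := fun y => [set x | B x y].

(* For B maximally monotone on a Hilbert space, (Id + B)^-1 x is a singleton
   for every x (Minty), and [xget 0] returns its element; the default value 0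
   only matters where that set is empty. *)
Definition resolvent (B : V -> set V) : V -> V :=
  fun x => xget 0 (inv_op (id_plus_op B) x).

Definition Fix (T : V -> V) : set V := [set x | T x = x].

End Operators.

Section ProductDot.
Variables (R : realType) (V : lmodType R) (ip : {dot V for idfun}) (m : nat).

Definition prod_ip (x y : {ffun 'I_m -> V}) : R := \sum_i ip (x i) (y i).

Let prod_ip_bilinear :
  bilinear_for (GRing.Scale.Law.clone _ _ *%R _)
    (GRing.Scale.Law.clone _ _ (idfun \; *%R) _) prod_ip.
Proof.
split=> y a u v; rewrite /prod_ip /= mulr_sumr -big_split; apply: eq_bigr => i _.
  by rewrite !ffunE linearPl.
by rewrite !ffunE linearPr.
Qed.

HB.instance Definition _ :=
  @bilinear_isBilinear.Build R _ _ R^o *%R (idfun \; *%R) prod_ip prod_ip_bilinear.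

Let prod_ip_sym x y : prod_ip x y = (-1) ^+ false * idfun (prod_ip y x).
Proof.
rewrite expr0 mul1r; apply: eq_bigr => i _.
by rewrite (@hermitian_subproof _ _ _ _ ip) expr0 mul1r.
Qed.

HB.instance Definition _ := isHermitianSesquilinear.Build _ _ _ _ prod_ip prod_ip_sym.

Let prod_ip_gt0 x : x != 0 -> 0 < prod_ip x x.
Proof.
move=> x0; have [i xi0] : exists i, x i != 0.
  apply/existsP; apply: contraNT x0 => /existsPn x_0; apply/eqP/ffunP => i.
  by rewrite ffunE; apply/eqP; rewrite -[_ == _]negbK x_0.
rewrite /prod_ip (bigD1 i) //= ltr_wpDr ?neq0_dnorm_gt0 //.
apply: sumr_ge0 => j _; have [->|xj0] := eqVneq (x j) 0; first by rewrite linear0l.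
exact/ltW/neq0_dnorm_gt0.
Qed.

HB.instance Definition _ := isDotProduct.Build _ _ prod_ip prod_ip_gt0.

Definition prod_dot : {dot {ffun 'I_m -> V} for idfun} := prod_ip.

End ProductDot.

Section FixedPointData.
Variables (R : realType) (V : lmodType R) (m : nat).
Variables (A : 'I_m -> V -> set V) (lambda : 'I_m -> R).

Definition mu (i : 'I_m) : R := 1 - lambda i.

Definition Rop (x : {ffun 'I_m -> V}) : {ffun 'I_m -> V} :=
  [ffun i => \sum_(j < m | j != i) (lambda j / mu i) *: x j].

Definition Jop (x : {ffun 'I_m -> V}) : {ffun 'I_m -> V} :=
  [ffun i => resolvent (scale_op (mu i)^-1 (A i)) (x i)].

Definition Sset : set {ffun 'I_m -> V} :=
  [set x | forall i, x i = resolvent (scale_op (mu i)^-1 (A i))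
                             (\sum_(j < m | j != i) (lambda j / mu i) *: x j)].

End FixedPointData.

(* Main.v *)
Require Import Defs.
From HB Require Import structures.
From mathcomp Require Import all_boot all_order all_algebra.
From mathcomp Require Import all_classical all_reals all_analysis.
From mathcomp Require Import ring lra.

Set Implicit Arguments.
Unset Strict Implicit.
Unset Printing Implicit Defensive.

Import Order.TTheory GRing.Theory Num.Theory.
Import numFieldNormedType.Exports.
Local Open Scope classical_set_scope.
Local Open Scope ring_scope.

(** Write T for the composition of Jop and Rop, and b = T x - T y, d = x - y.

    By Minty's theorem ([minty]) every resolvent is defined on all of X and is
    firmly nonexpansive ([resolvent_firm]), hence so is Jop coordinatewise:
    <b, b> <= <b, Rop x - Rop y>.  As all weights are 1/m, Rop is linear, is the
    identity on the diagonal and is multiplication by -1/(m-1) on the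
    orthogonal complement of the diagonal.  So Rop x - Rop y = d - m/(m-1) e,
    where e is the component of d orthogonal to the diagonal ([RopB]).  These
    two facts give the averagedness inequality ([averaged_estimate]): with
    M = m, it remains to see that
    -(M+2) |b - d|^2 - 4 M^2/(M-1) <b, e> is nonpositive, which follows by
    completing the square in b - d because <e, d> = |e|^2 and
    M^2 <= (M+2)(M-1).

    Minty's theorem is proved by minimising, over X * X, the Fitzpatrick
    function sup over (y,v) in the graph of <x,v> + <u,y> - <y,v>, plus
    (|x|^2 + |u|^2)/2.  This is a strongly convex lower semicontinuous function,
    so a minimising sequence is Cauchy and the minimum is attained
    ([fitz_minimizer]).  At the minimiser (x, u), the first-order condition and
    maximality put (-u, -x) in the graph, and the condition at that very
    point forces x = -u, whence 0 is in x + B x ([minty0]).  The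
    general case follows by scaling and translating B.

    The fixed points of T are the points of S by unfolding both sides. *)

(** * Real inner products *)

Section DotTheory.
Variables (R : realType) (V : lmodType R) (ip : {dot V for idfun}).

Lemma dotC x y : ip x y = ip y x.
Proof. by rewrite (@hermitian_subproof _ _ _ _ ip) expr0 mul1r. Qed.

Lemma dotDl x y z : ip (x + y) z = ip x z + ip y z.
Proof. exact: linearDl. Qed.

Lemma dotDr x y z : ip z (x + y) = ip z x + ip z y.
Proof. exact: linearDr. Qed.

Lemma dotNl x z : ip (- x) z = - ip x z.
Proof. exact: linearNl. Qed.

Lemma dotNr x z : ip z (- x) = - ip z x.
Proof. exact: linearNr. Qed.

Lemma dotZl a x z : ip (a *: x) z = a * ip x z.
Proof. exact: linearZl_LR. Qed.

Lemma dotZr a x z : ip z (a *: x) = a * ip z x.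
Proof. exact: linearZr_LR. Qed.

(** Rewriting with [dotE] expands a bilinear expression completely. *)
Definition dotE := (dotDl, dotDr, dotNl, dotNr, dotZl, dotZr).

Lemma dot_ge0 x : 0 <= ip x x.
Proof.
have [->|x0] := eqVneq x 0; first by rewrite linear0l.
exact/ltW/neq0_dnorm_gt0.
Qed.

Lemma dot_le0_eq0 x : ip x x <= 0 -> x = 0.
Proof.
move=> xx; apply/eqP; apply: contraTT xx => x0; rewrite -ltNge.
exact: neq0_dnorm_gt0.
Qed.

Lemma ler_ip_norm x y : (ip_norm ip x <= ip_norm ip y) = (ip x x <= ip y y).
Proof. by rewrite /ip_norm ler_sqrt // dot_ge0. Qed.

(** A mapping is alpha-averaged as soon as N := alpha^-1 (T - (1 - alpha) Id)
    is nonexpansive; the hypothesis is the inequality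
    |b - (1 - alpha) d|^2 <= alpha^2 |d|^2 expanded, where d = x - y and
    b = T x - T y. *)
Lemma averaged_ineq (alpha : R) (T : V -> V) : 0 < alpha < 1 ->
  (forall x y, ip (T x - T y) (T x - T y) + (1 - 2 * alpha) * ip (x - y) (x - y)
     <= 2 * (1 - alpha) * ip (T x - T y) (x - y)) ->
  averaged ip alpha T.
Proof.
move=> /andP[a0 a1] H; split; first by rewrite ltW.
exists (fun x => alpha^-1 *: (T x - (1 - alpha) *: x)); split; last first.
  by move=> x; rewrite scalerA divff ?gt_eqF // scale1r addrC subrK.
move=> x y; rewrite ler_ip_norm -scalerBr.
set d := x - y; set b := T x - T y.
have -> : T x - (1 - alpha) *: x - (T y - (1 - alpha) *: y)
          = b - (1 - alpha) *: d.
  by rewrite /b /d scalerBr opprD addrACA -opprD.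
have := H x y; rewrite -/b -/d => {H}; clearbody b d => Hbd.
rewrite dotZl dotZr ler_pdivrMl // ler_pdivrMl // !dotE (dotC d b).
by lra.
Qed.

End DotTheory.

(** * Sequences in a Hilbert space *)

Section Hilbert.
Variables (R : realType) (X : completeNormedModType R) (ip : {dot X for idfun}).
Hypothesis hnorm : forall x : X, `|x| = ip_norm ip x.

Lemma dot_norm x : ip x x = `|x| ^+ 2.
Proof. by rewrite hnorm /ip_norm sqr_sqrtr // dot_ge0. Qed.

Lemma cauchy_schwarz x y : ip x y <= `|x| * `|y|.
Proof.
have [->|x0] := eqVneq x 0; first by rewrite linear0l normr0 mul0r.
have [->|y0] := eqVneq y 0; first by rewrite linear0r normr0 mulr0.
have nx : 0 < `|x| by rewrite normr_gt0.
have ny : 0 < `|y| by rewrite normr_gt0.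
have := dot_ge0 ip (`|y| *: x - `|x| *: y).
rewrite !dotE (dotC _ y x) !dot_norm => H.
have : 0 <= 2 * (`|x| * `|y|) * (`|x| * `|y| - ip x y) by lra.
by rewrite pmulr_rge0 ?subr_ge0 // !mulr_gt0.
Qed.

Lemma cvg_dotl (x : nat -> X) (l v : X) : x @ \oo --> l ->
  (ip (x n) v) @[n --> \oo] --> ip l v.
Proof.
move=> xl; apply/cvgrPdist_le => e e0.
have v1 : 0 < `|v| + 1 by rewrite ltr_wpDl.
have /cvgrPdist_le/(_ (e / (`|v| + 1)) (divr_gt0 e0 v1)) := xl.
apply: filterS => n xn.
have le_e : `|l - x n| * `|v| <= e.
  rewrite -(ler_pM2r v1) in xn; rewrite divfK ?gt_eqF // in xn.
  apply: le_trans xn; apply: ler_wpM2l => //; lra.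
rewrite ler_norml -[ip l v - _]/(ip l v + - _) -dotNl -dotDl.
have := cauchy_schwarz (l - x n) v.
have := cauchy_schwarz (l - x n) (- v).
by rewrite normrN dotNr => H1 H2; apply/andP; split; lra.
Qed.

Lemma cvg_dot_sq (x : nat -> X) (l : X) : x @ \oo --> l ->
  (ip (x n) (x n)) @[n --> \oo] --> ip l l.
Proof.
move=> xl; rewrite dot_norm expr2.
under eq_fun do rewrite dot_norm expr2.
by apply: cvgM; apply: cvg_norm.
Qed.

(** Completeness of X, for a Cauchy estimate stated on the squared norm. *)
Lemma cvg_of_dot_cauchy (x : nat -> X) (c : R) : 0 < c ->
  (forall n k, ip (x n - x k) (x n - x k) <= c * (harmonic n + harmonic k)) ->
  cvg (x @ \oo).
Proof.
move=> c0 H; apply/cauchy_cvgP/cauchy_exP => e e0.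
have d0 : 0 < e ^+ 2 / (2 * c) by rewrite divr_gt0 ?exprn_gt0 ?mulr_gt0.
have [N _ HN] := near_infty_natSinv_lt (PosNum d0).
exists (x N); exists N => // n /= Nn; rewrite -ball_normE /=.
rewrite -(ltr_pXn2r (n := 2)) ?nnegrE ?(ltW e0) // -dot_norm.
apply: le_lt_trans (H N n) _.
have := HN N (leqnn N); have := HN n Nn; rewrite /= => h1 h2.
have : harmonic N + harmonic n < e ^+ 2 / c.
  have -> : e ^+ 2 / c = e ^+ 2 / (2 * c) + e ^+ 2 / (2 * c) by field; lra.
  exact: ltrD.
by rewrite ltr_pdivlMr // mulrC.
Qed.

End Hilbert.

(** * Minty's theorem *)

Section Minty.
Variables (R : realType) (X : completeNormedModType R) (ip : {dot X for idfun}).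
Hypothesis hnorm : forall x : X, `|x| = ip_norm ip x.

(** The supremum of [fitz_term x u y v] over the graph points (y, v) of B is the
    Fitzpatrick function of B at (x, u) plus (|x|^2 + |u|^2)/2.  That supremum
    may be infinite, so it only enters through its upper bounds. *)
Definition fitz_term (x u y v : X) : R :=
  ip x v + ip u y - ip y v + 2^-1 * (ip x x + ip u u).

(** The regularised Fitzpatrick function attains its minimum, with value t. *)
Lemma fitz_minimizer (B : X -> set X) : monotone_op ip B ->
  (exists y v, B y v) ->
  exists x u t, (forall y v, B y v -> fitz_term x u y v <= t) /\
    forall x' u' s, (forall y v, B y v -> fitz_term x' u' y v <= s) -> t <= s.
Proof.
move=> Bmon [y0 [v0 B0]].
pose ub x u s := forall y v, B y v -> fitz_term x u y v <= s.
(* E is the projection of the epigraph to the value axis. *)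
pose E : set R := [set s | exists x u, ub x u s].
have infE : has_inf E.
  split.
    (* At a graph point the Fitzpatrick function equals the inner product. *)
    exists (ip y0 v0 + 2^-1 * (ip y0 y0 + ip v0 v0)), y0, v0 => y v Byv.
    rewrite /fitz_term lerD2r.
    have := Bmon _ _ _ _ B0 Byv; rewrite !dotE (dotC _ v0 y); lra.
  exists (- (2^-1 * ip (y0 + v0) (y0 + v0))) => s [x [u /(_ _ _ B0)]].
  have := dot_ge0 ip (x + v0); have := dot_ge0 ip (u + y0).
  rewrite /fitz_term !dotE (dotC _ v0 x) (dotC _ y0 u) (dotC _ v0 y0); lra.
have t_min x u s : ub x u s -> inf E <= s.
  by move=> H; apply: (ge_inf infE.2); exists x, u.
have /choice[z zub] (n : nat) : exists z, ub z.1 z.2 (inf E + harmonic n).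
  have [s [x [u xu]] sE] := inf_adherent (harmonic_gt0 (R := R) n) infE.
  by exists (x, u) => y v Byv; apply: le_trans (xu y v Byv) (ltW sE).
have dist n k : ip ((z n).1 - (z k).1) ((z n).1 - (z k).1) +
    ip ((z n).2 - (z k).2) ((z n).2 - (z k).2) <= 4 * (harmonic n + harmonic k).
  (* Strong convexity, at the midpoint of z n and z k. *)
  pose x := 2^-1 *: ((z n).1 + (z k).1); pose u := 2^-1 *: ((z n).2 + (z k).2).
  have : ub x u (inf E + 2^-1 * (harmonic n + harmonic k)
     - 8^-1 * (ip ((z n).1 - (z k).1) ((z n).1 - (z k).1) +
               ip ((z n).2 - (z k).2) ((z n).2 - (z k).2))).
    move=> y v Byv; have := zub n y v Byv; have := zub k y v Byv.
    rewrite /fitz_term /x /u !dotE (dotC _ (z k).1 (z n).1).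
    rewrite (dotC _ (z k).2 (z n).2); lra.
  by move/t_min; lra.
have /cvg_ex[x zx] : cvg ((z n).1 @[n --> \oo]).
  apply: (@cvg_of_dot_cauchy _ _ ip hnorm _ 4) => // n k.
  by apply: le_trans (dist n k); rewrite lerDl dot_ge0.
have /cvg_ex[u zu] : cvg ((z n).2 @[n --> \oo]).
  apply: (@cvg_of_dot_cauchy _ _ ip hnorm _ 4) => // n k.
  by apply: le_trans (dist n k); rewrite lerDr dot_ge0.
exists x, u, (inf E); split=> [y v Byv|]; last exact: t_min.
have lhs_cvg : (fitz_term (z n).1 (z n).2 y v) @[n --> \oo]
    --> fitz_term x u y v.
  rewrite /fitz_term; apply: cvgD.
    apply: cvgB; last exact: cvg_cst.
    by apply: cvgD; apply: cvg_dotl.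
  by apply: cvgMl_tmp; apply: cvgD; apply: cvg_dot_sq.
have rhs_cvg : (inf E + harmonic n) @[n --> \oo] --> inf E.
  rewrite -[X in _ --> X]addr0; apply: cvgD; first exact: cvg_cst.
  exact: cvg_harmonic.
apply: ler_cvg_to lhs_cvg rhs_cvg _.
by apply: nearW => n; exact: zub.
Qed.

(** If c t + d t^2 is nonnegative for 0 < t <= 1, then so is the slope c. *)
Lemma ge0_of_quadratic (c d : R) : 0 <= d ->
  (forall t, 0 < t <= 1 -> 0 <= c * t + d * t ^+ 2) -> 0 <= c.
Proof.
move=> d0 H; rewrite leNgt; apply/negP => c0.
have dc : 0 < d - c by lra.
(* The point -c/(d - c) lies in (0, 1] and c + d t is negative there. *)
have := H (- c / (d - c)); rewrite divr_gt0 ?oppr_gt0 //= ler_pdivrMr //.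
have -> : c * (- c / (d - c)) + d * (- c / (d - c)) ^+ 2
   = c ^+ 3 / (d - c) ^+ 2 by field; lra.
rewrite mul1r lerDr d0 => /(_ isT); rewrite leNgt => /negP; apply.
rewrite pmulr_llt0 ?invr_gt0 ?exprn_gt0 // exprS pmulr_llt0 //.
by rewrite exprn_even_gt0 //= lt_eqF.
Qed.

(** Minty's theorem at 0.  Maximality is used only in the form of
    [maximally_monotone_mem], which is stable under scaling and translation. *)
Lemma minty0 (B : X -> set X) : monotone_op ip B ->
  (forall x u, (forall y v, B y v -> 0 <= ip (x - y) (u - v)) -> B x u) ->
  exists x, B x (- x).
Proof.
move=> Bmon Bmax.
have B_witness x u : exists y v, B y v /\ ip (x - y) (u - v) <= 0.
  have [Bxu|Bxu] := pselect (B x u).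
    by exists x, u; split=> //; rewrite subrr linear0l.
  apply: contrapT => H; apply: Bxu; apply: Bmax => y v Byv.
  rewrite leNgt; apply/negP => lt0; apply: H; exists y, v; split=> //.
  exact: ltW.
have [|x [u [t [tub tmin]]]] := fitz_minimizer Bmon.
  by have [y [v [Byv _]]] := B_witness 0 0; exists y, v.
pose q := 2^-1 * (ip x x + ip u u).
(* The Fitzpatrick function dominates the inner product. *)
have t_ge : ip x u + q <= t.
  have [y [v [Byv]]] := B_witness x u.
  have := tub y v Byv; rewrite /fitz_term -/q !dotE (dotC _ y u); lra.
(* Optimality of (x, u) along the segment towards a graph point (y, v), where
   the Fitzpatrick function is convex. *)
have first_order y v : B y v -> t + q <= ip y v + ip x y + ip u v.
  move=> Byv; rewrite -subr_ge0.
  pose d := 2^-1 * (ip (y - x) (y - x) + ip (v - u) (v - u)).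
  apply: (@ge0_of_quadratic _ d).
    by rewrite mulr_ge0 ?invr_ge0 ?addr_ge0 ?dot_ge0.
  move=> a /andP[a0 a1].
  have seg_ub y' v' : B y' v' ->
      fitz_term (x + a *: (y - x)) (u + a *: (v - u)) y' v'
      <= (1 - a) * (t - q) + a * ip y v +
         2^-1 * (ip (x + a *: (y - x)) (x + a *: (y - x)) +
                 ip (u + a *: (v - u)) (u + a *: (v - u))).
    move=> Byv'; rewrite /fitz_term lerD2r.
    have a1' : 0 <= 1 - a by rewrite subr_ge0.
    have := ler_wpM2l a1' (tub y' v' Byv').
    have := mulr_ge0 (ltW a0) (Bmon _ _ _ _ Byv Byv').
    by rewrite /fitz_term -/q !dotE (dotC _ v y'); lra.
  have := tmin _ _ _ seg_ub.
  by rewrite -subr_ge0 /d /q !dotE (dotC _ y x) (dotC _ v u); lra.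
have Bux : B (- u) (- x).
  apply: Bmax => y v Byv.
  have := first_order y v Byv.
  have := dot_ge0 ip (x + u).
  move: t_ge; rewrite /q !dotE (dotC _ u x) (dotC _ y x); lra.
have xu0 : x + u = 0.
  apply: (@dot_le0_eq0 _ _ ip).
  have := first_order _ _ Bux.
  move: t_ge; rewrite /q !dotE (dotC _ u x); lra.
exists x; move: Bux.
by rewrite (_ : - u = x) //; apply/eqP; rewrite eq_sym -addr_eq0 xu0.
Qed.


(** A point monotonically related to the whole graph belongs to it. *)
Lemma maximally_monotone_mem (B : X -> set X) : maximally_monotone ip B ->
  forall x u, (forall y v, B y v -> 0 <= ip (x - y) (u - v)) -> B x u.
Proof.
move=> [Bmon Bmax] x u H.
pose C y : set X := [set v | B y v \/ (y = x /\ v = u)].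
have <- : C = B.
  apply: Bmax; last by move=> y v Byv; left.
  move=> y z v w [Byv|[-> ->]] [Bzw|[-> ->]].
  - exact: Bmon.
  - by rewrite -opprB -[v - u]opprB dotNl dotNr opprK; exact: H.
  - exact: H.
  - by rewrite subrr linear0l.
by right.
Qed.

(** Minty's theorem: Id + c B is surjective. *)
Lemma minty (B : X -> set X) (c : R) (z : X) : 0 < c ->
  maximally_monotone ip B -> exists x u, B x u /\ x + c *: u = z.
Proof.
move=> c0 Bmm; have c1 : 0 < c^-1 by rewrite invr_gt0.
have Bmax := maximally_monotone_mem Bmm.
(* C = c B - z, so that a solution of 0 in x + C x solves z in x + c B x. *)
pose C x : set X := [set w | B x (c^-1 *: (w + z))].
have CE (w w' : X) : c^-1 *: (w + z) - c^-1 *: (w' + z) = c^-1 *: (w - w').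
  by rewrite -scalerBr opprD addrACA subrr addr0.
have [x y v w Cxv Cyw|x w H|x Cx] := @minty0 C.
- have := Bmm.1 _ _ _ _ Cxv Cyw.
  by rewrite CE dotZr pmulr_rge0.
- apply: Bmax => y v Byv.
  have vE : v = c^-1 *: (c *: v - z + z).
    by rewrite subrK scalerA mulVf ?gt_eqF // scale1r.
  rewrite vE CE dotZr pmulr_rge0 //; apply: H.
  by rewrite /C /= -vE.
- exists x, (c^-1 *: (- x + z)); split=> //.
  by rewrite scalerA divff ?gt_eqF // scale1r addrA subrr add0r.
Qed.

Lemma resolventP (B : X -> set X) (c : R) (z : X) : 0 < c ->
  maximally_monotone ip B ->
  exists2 u, B (resolvent (scale_op c B) z) u
           & z = resolvent (scale_op c B) z + c *: u.
Proof.
move=> c0 Bmm; rewrite /resolvent.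
have [x [u [Bxu xuz]]] := minty z c0 Bmm.
have : exists x, inv_op (id_plus_op (scale_op c B)) z x.
  by exists x, (c *: u); [exists u|].
by move=> /(xgetPex 0)[_ [v Bv <-] zE]; exists v.
Qed.

Lemma resolvent_firm (B : X -> set X) (c : R) (x y : X) : 0 < c ->
  maximally_monotone ip B ->
  ip (resolvent (scale_op c B) x - resolvent (scale_op c B) y)
     (resolvent (scale_op c B) x - resolvent (scale_op c B) y)
    <= ip (resolvent (scale_op c B) x - resolvent (scale_op c B) y) (x - y).
Proof.
move=> c0 Bmm.
have [u Bu xE] := resolventP x c0 Bmm.
have [v Bv yE] := resolventP y c0 Bmm.
set p := resolvent _ x in Bu xE *; set q := resolvent _ y in Bv yE *.
have -> : x - y = (p - q) + c *: (u - v).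
  by rewrite xE yE scalerBr opprD addrACA.
by rewrite [leRHS]dotDr dotZr lerDl pmulr_rge0 //; exact: Bmm.1.
Qed.

End Minty.

(** * The averagedness estimate *)

Section Estimate.
Variables (R : realType) (V : lmodType R) (ip : {dot V for idfun}).

(** Here e is the component of d orthogonal to a subspace, and
    d - M/(M-1) e is the image of d under the map which is the identity on that
    subspace and multiplication by -1/(M-1) on its orthogonal complement. *)
Lemma averaged_estimate (M : R) (b d e : V) : 2 <= M ->
  ip e (d - e) = 0 -> ip b b <= ip b (d - (M / (M - 1)) *: e) ->
  ip b b + (1 - 2 * (2 * M / (3 * M - 2))) * ip d d
    <= 2 * (1 - 2 * M / (3 * M - 2)) * ip b d.
Proof.
move=> M2; set k := M / (M - 1) => ed bb.
have M1n : M - 1 != 0 by rewrite gt_eqF //; lra.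
have M2n : M + 2 != 0 by rewrite gt_eqF //; lra.
have M3n : 3 * M - 2 != 0 by rewrite gt_eqF //; lra.
(* The t that completes the square: (M+2) |w + t e|^2 with w = b - d has cross
   term 4 M k <w, e>. *)
pose t := 2 * M * k / (M + 2).
have coef : 0 <= 4 * M * k - (M + 2) * t ^+ 2.
  have -> : 4 * M * k - (M + 2) * t ^+ 2
    = 4 * M ^+ 2 * (M - 2) / ((M - 1) ^+ 2 * (M + 2)).
    by rewrite /t /k; field; rewrite ?M1n ?M2n ?M3n.
  by rewrite divr_ge0 ?mulr_ge0 ?exprn_ge0 //; lra.
have := mulr_ge0 coef (dot_ge0 ip e).
have M20 : 0 <= M + 2 by lra.
have := mulr_ge0 M20 (dot_ge0 ip (b - d + t *: e)).
have M0 : 0 <= 4 * M by lra.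
have := ler_wpM2l M0 bb.
move: ed; rewrite !dotE (dotC _ d b) (dotC _ e b) (dotC _ d e) => /subr0_eq ed.
rewrite ed.
have tE : (M + 2) * t = 2 * M * k by rewrite /t; field; rewrite ?M1n ?M2n ?M3n.
set BB := ip b b; set DD := ip d d; set BD := ip b d; set BE := ip b e.
set EE := ip e e => h1 h2 h3.
have D0 : 0 < 3 * M - 2 by lra.
rewrite -(ler_pM2l D0).
have -> : (3 * M - 2) * (BB + (1 - 2 * (2 * M / (3 * M - 2))) * DD)
  = (3 * M - 2) * BB - (M + 2) * DD by field; rewrite ?M1n ?M2n ?M3n.
have -> : (3 * M - 2) * (2 * (1 - 2 * M / (3 * M - 2)) * BD)
  = 2 * (M - 2) * BD by field; rewrite ?M1n ?M2n ?M3n.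
have := congr1 ( *%R^~ BE) tE; have := congr1 ( *%R^~ EE) tE.
move: h1 h2 h3; clearbody t k BB DD BD BE EE; lra.
Qed.

End Estimate.

(** * The operators on the product space *)

Section Product.
Variables (R : realType) (X : completeNormedModType R) (ip : {dot X for idfun}).
Hypothesis hnorm : forall x : X, `|x| = ip_norm ip x.
Variables (m : nat) (A : 'I_m -> X -> set X) (lambda : 'I_m -> R).
Hypothesis hm : (3 <= m)%N.
Hypothesis hA : forall i, maximally_monotone ip (A i).
Hypothesis hlambda : forall i, lambda i = 1 / m%:R.

Lemma natr_ge3 : 3 <= m%:R :> R.
Proof. by rewrite ler_nat. Qed.

Lemma mu_gt0 i : 0 < mu lambda i.
Proof.
have := natr_ge3 => h; rewrite /mu hlambda subr_gt0 ltr_pdivrMr; lra.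
Qed.

(** The deviation of d from its mean: its component orthogonal to the diagonal
    of the product space. *)
Definition dev (d : {ffun 'I_m -> X}) : {ffun 'I_m -> X} :=
  [ffun i => d i - m%:R^-1 *: \sum_j d j].

Lemma dev_orth d : prod_dot ip m (dev d) (d - dev d) = 0.
Proof.
have := natr_ge3 => h.
rewrite /prod_dot /= /prod_ip.
under eq_bigr do rewrite !ffunE opprB addrCA subrr addr0.
rewrite -linear_sumlz sumrB sumr_const card_ord -scaler_nat scalerA.
by rewrite divff ?scale1r ?subrr ?linear0l // gt_eqF //; lra.
Qed.

Lemma RopB x y : Rop lambda x - Rop lambda y =
  (x - y) - (m%:R / (m%:R - 1)) *: dev (x - y).
Proof.
have := natr_ge3 => h.
apply/ffunP => i; rewrite !ffunE -sumrB.
set d := x - y.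
have -> : \sum_(j | j != i)
    (lambda j / mu lambda i *: x j - lambda j / mu lambda i *: y j)
  = (m%:R - 1)^-1 *: (\sum_j d j - d i).
  rewrite [in RHS](bigD1 i) //= addrC addrK scaler_sumr; apply: eq_bigr => j _.
  rewrite -scalerBr !ffunE /mu !hlambda; congr (_ *: _); field; lra.
have -> : x i - y i = d i by rewrite !ffunE.
have Mn : m%:R != 0 :> R by rewrite gt_eqF //; lra.
have M1n : m%:R - 1 != 0 :> R by rewrite gt_eqF //; lra.
set k := m%:R / (m%:R - 1).
have -> : (m%:R - 1)^-1 = k / m%:R by rewrite /k; field; rewrite Mn M1n.
have -> : d i - k *: (d i - m%:R^-1 *: \sum_j d j)
   = (1 - k) *: d i + (k / m%:R) *: \sum_j d j.
  by rewrite scalerBr scalerA opprB scalerBl scale1r addrA addrAC.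
have -> : 1 - k = - (k / m%:R) by rewrite /k; field; rewrite Mn M1n.
by rewrite scalerBr scaleNr addrC.
Qed.

Lemma Jop_firm x y :
  prod_dot ip m (Jop A lambda x - Jop A lambda y) (Jop A lambda x - Jop A lambda y)
  <= prod_dot ip m (Jop A lambda x - Jop A lambda y) (x - y).
Proof.
rewrite /prod_dot /= /prod_ip; apply: ler_sum => i _; rewrite !ffunE.
by apply: resolvent_firm => //; rewrite invr_gt0 mu_gt0.
Qed.

Lemma JopRop_averaged :
  averaged (prod_dot ip m) (2 * m%:R / (3 * m%:R - 2))
    (Jop A lambda \o Rop lambda).
Proof.
have := natr_ge3 => h.
apply: averaged_ineq => [|x y].
  by rewrite divr_gt0 ?ltr_pdivrMr /=; lra.
apply: (@averaged_estimate _ _ _ m%:R _ _ (dev (x - y))); first lra.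
  exact: dev_orth.
by rewrite -RopB; exact: Jop_firm.
Qed.

Lemma Fix_JopRop : Fix (Jop A lambda \o Rop lambda) = Sset A lambda.
Proof.
apply/seteqP; split=> x /=.
  by move=> xE i; move/ffunP: xE => /(_ i); rewrite !ffunE => <-.
by move=> xE; apply/ffunP => i; rewrite !ffunE -xE.
Qed.

End Product.

(* X is a real Hilbert space: a complete normed space whose norm is induced by
   the inner product ip. *)
Theorem corollary3p8 (R : realType) (X : completeNormedModType R)
  (ip : {dot X for idfun}) (hnorm : forall x : X, `|x| = ip_norm ip x)
  (hX : exists x : X, x != 0)
  (m : nat) (hm : (3 <= m)%N)
  (A : 'I_m -> X -> set X) (hA : forall i, maximally_monotone ip (A i))
  (lambda : 'I_m -> R) (hlambda : forall i, lambda i = 1 / m%:R) :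
  averaged (prod_dot ip m) (2 * m%:R / (3 * m%:R - 2))
    (Jop A lambda \o Rop lambda) /\
  Fix (Jop A lambda \o Rop lambda) = Sset A lambda.
Proof. by split; [exact: JopRop_averaged | exact: Fix_JopRop]. Qed.
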